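(* Fix a real number $\beta$ with $\frac12 < \beta < 1$ and an integer $t \ge 5$. Then the number of integers $n$ with $\mathrm{e}^{t-1} < n \le \mathrm{e}^t$ such that $Z(n) < n^\beta$ is at most $196\, t^2 \mathrm{e}^{\beta t}$.
   Context: For a positive integer $m$ let $T(m) = m(m+1)/2$. The pseudo-Smarandache function is defined for positive integers $n$ by $Z(n) = \min\{ m \ge 1 : n \mid T(m) \}$. Here $\mathrm{e}$ is the base of the natural logarithm. *)

(* Defs.v *)
From mathcomp Require Import all_boot all_order all_algebra finmap.
From mathcomp Require Import all_classical all_reals all_analysis.

Set Implicit Arguments.
Unset Strict Implicit.
Unset Printing Implicit Defensive.

Import Order.TTheory GRing.Theory Num.Theory.

Local Open Scope classical_set_scope.
Local Open Scope ring_scope.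

Definition triangular (m : nat) : nat := ((m * (m + 1)) %/ 2)%N.

Lemma exists_dvdn_triangular (n : nat) :
  exists m : nat, (0 < m)%N && (n.+1 %| triangular m)%N.
Proof.
exists (2 * n.+1)%N; rewrite muln_gt0 /= /triangular -mulnA mulKn //.
exact: dvdn_mulr.
Qed.

(* The pseudo-Smarandache function; only its values at n > 0 are meaningful,
   Z 0 is a default value. *)
Definition Z (n : nat) : nat :=
  if n is n'.+1 then ex_minn (exists_dvdn_triangular n') else 0%N.

Definition small_Z (R : realType) (beta : R) (t : nat) : set nat :=
  [set n : nat | expR (t%:R - 1 : R) < n%:R <= expR (t%:R : R)
                 /\ (Z n)%:R < (n%:R : R) `^ beta].

(* [fset_set] is the actual set of elements only for finite sets. *)
Lemma finite_small_Z (R : realType) (beta : R) (t : nat) :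
  finite_set (small_Z beta t).
Proof.
apply: (sub_finite_set _ (finite_II (Num.bound (expR (t%:R : R))))).
move=> n [/andP[_ le_n] _] /=; rewrite -(ltr_nat R).
by apply: le_lt_trans le_n _; apply: archi_boundP; exact: expR_ge0.
Qed.

(* Main.v *)
Require Import Defs.
From mathcomp Require Import all_boot all_order all_algebra finmap.
From mathcomp Require Import all_classical all_reals all_analysis.
From mathcomp Require Import ring lra zify.

Import Order.TTheory GRing.Theory Num.Theory.

Local Open Scope classical_set_scope.
Local Open Scope ring_scope.

(** If [Z n = m < n ^ beta] then [m <= K := floor (e ^ (beta * t))] and [n]
    divides [m (m + 1)], so the count is at most the sum over [m <= K] of
    [d m * d (m + 1)], where [d] is the number of divisors.  Pairing [a] with
    [m / a] bounds [d m] by twice the number of divisors of [m] that are at most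
    [sqrt (K + 1)].  For [a, b <= sqrt (K + 1)] the [m <= K] with [a %| m] and
    [b %| m + 1] lie in a single class modulo [a b <= K + 1], so there are at
    most [K / (a b) + 1 <= 3 K / (a b)] of them, and the total is at most
    [12 K] times the square of the harmonic number of [K + 1]. *)

(** Every divisor [d] of [m * n] is the product of [g = gcdn d m], a divisor of [m], and [d %/ g].
    The latter divides [n] by Gauss's lemma: it divides [(m %/ g) * n] and is coprime to
    [m %/ g]. *)
Lemma size_divisorsM (m n : nat) : (0 < m)%N -> (0 < n)%N ->
  (size (divisors (m * n)) <= size (divisors m) * size (divisors n))%N.
Proof.
move=> m0 n0; rewrite -(size_allpairs muln).
apply: uniq_leq_size (divisors_uniq _) _ => d.
rewrite -dvdn_divisors ?muln_gt0 ?m0 // => dmn.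
have d0 : (0 < d)%N by apply: dvdn_gt0 dmn; rewrite muln_gt0 m0.
have g0 : (0 < gcdn d m)%N by rewrite gcdn_gt0 d0.
apply/allpairsP; exists (gcdn d m, d %/ gcdn d m)%N; split => /=.
- by rewrite -dvdn_divisors // dvdn_gcdr.
- rewrite -dvdn_divisors //.
  have cop : coprime (d %/ gcdn d m) (m %/ gcdn d m).
    rewrite /coprime -(eqn_pmul2r g0) mul1n muln_gcdl.
    by rewrite !divnK ?dvdn_gcdl ?dvdn_gcdr.
  rewrite -(Gauss_dvdr _ cop) -(dvdn_pmul2r g0) divnK ?dvdn_gcdl //.
  by rewrite mulnAC divnK ?dvdn_gcdr.
- by rewrite mulnC divnK ?dvdn_gcdl.
Qed.

(** The map [a |-> m %/ a] sends divisors with [a * a > m] injectively to divisors whose square is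
    at most [m]. *)
Lemma size_divisors_le_sqrt (m : nat) : (0 < m)%N ->
  (size (divisors m) <= 2 * count (fun a => a * a <= m) (divisors m))%N.
Proof.
move=> m0; rewrite -(count_predC (fun a => a * a <= m)%N) mul2n -addnn leq_add2l.
rewrite -!size_filter -(size_map (fun a => m %/ a)%N).
apply: uniq_leq_size.
  rewrite map_inj_in_uniq ?filter_uniq ?divisors_uniq // => a b.
  rewrite !mem_filter -!dvdn_divisors // => /andP[_ /dvdnP[k mk]] /andP[_ bm].
  have /andP[k0 a0] : (0 < k)%N && (0 < a)%N by rewrite -muln_gt0 -mk.
  rewrite {1}mk mulnK // => kE; apply/eqP.
  by rewrite -(eqn_pmul2l k0) -mk kE divnK.
move=> q /mapP[a]; rewrite !mem_filter -!dvdn_divisors // => /andP[/= am].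
move=> /dvdnP[k mk]; have /andP[k0 a0] : (0 < k)%N && (0 < a)%N.
  by rewrite -muln_gt0 -mk.
rewrite {1}mk mulnK // => ->; rewrite {2}mk dvdn_mulr // andbT.
rewrite {1}mk leq_mul2l; apply/orP; right; apply: ltnW.
by move: am; rewrite -ltnNge {1}mk ltn_mul2r => /andP[].
Qed.

(** Cutting off at [N] instead of [m] makes the range of [a] independent of [m], so that sums over
    [m] and [a] can be exchanged. *)
Lemma size_divisors_le_sum (m N : nat) : (0 < m <= N)%N ->
  (size (divisors m) <= 2 * \sum_(1 <= a < N.+1 | a * a <= N) (a %| m))%N.
Proof.
move=> /andP[m0 mN]; apply: leq_trans (size_divisors_le_sqrt m m0) _.
rewrite leq_mul2l /= -big_mkcondr sum1_count -!size_filter.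
apply: uniq_leq_size; first by rewrite filter_uniq // divisors_uniq.
move=> a; rewrite !mem_filter -dvdn_divisors // mem_index_iota.
move=> /andP[aa am]; rewrite am (leq_trans aa mN) /=.
by rewrite ltnS (dvdn_gt0 m0 am) (leq_trans (dvdn_leq m0 am) mN).
Qed.

(** Within one class modulo [d] the quotient [m %/ d] determines [m], and it takes values from [0]
    to [K %/ d]. *)
Lemma count_modn_le (K d : nat) (P : pred nat) :
  (forall m m', P m -> P m' -> m = m' %[mod d]) ->
  (count P (index_iota 1 K.+1) <= (K %/ d).+1)%N.
Proof.
move=> Pd; rewrite -size_filter -(size_map (fun m => m %/ d)%N).
rewrite -[leqRHS](size_iota 0); apply: uniq_leq_size.
  rewrite map_inj_in_uniq ?filter_uniq ?iota_uniq // => m m'.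
  rewrite !mem_filter => /andP[Pm _] /andP[Pm' _] q.
  by rewrite (divn_eq m d) (divn_eq m' d) q (Pd m m').
move=> q /mapP[m]; rewrite mem_filter mem_index_iota => /andP[_ /andP[_ mK]] ->.
by rewrite mem_iota /= add0n ltnS leq_div2r.
Qed.

Lemma count_dvdn_consecutive (K a b : nat) :
  (\sum_(1 <= m < K.+1) (a %| m) * (b %| m.+1) <= (K %/ (a * b)).+1)%N.
Proof.
under eq_bigr => m _ do rewrite mulnb.
rewrite -big_mkcond sum1_count.
apply: count_modn_le => m m' /andP[am bm] /andP[am' bm'].
(* Coprimality is not assumed: any [m] that is counted forces it, as [a] and [b] divide consecutive
   integers. *)
have cop : coprime a b.
  by apply: (coprime_dvdl am); apply: (coprime_dvdr bm); apply: coprimenS.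
apply/eqP; rewrite chinese_remainder //; apply/andP; split.
  by move: am am'; rewrite /dvdn => /eqP -> /eqP ->.
rewrite -(eqn_modDr 1) !addn1.
by move: bm bm'; rewrite /dvdn => /eqP -> /eqP ->.
Qed.

Lemma sum_size_divisors_le (K : nat) :
  (\sum_(1 <= m < K.+1) size (divisors (m * m.+1)) <=
   4 * \sum_(1 <= a < K.+2 | a * a <= K.+1)
         \sum_(1 <= b < K.+2 | b * b <= K.+1) (K %/ (a * b)).+1)%N.
Proof.
(* The cut-off [K.+1] serves both [m] and [m.+1] for all [m <= K]. *)
pose D m := (\sum_(1 <= a < K.+2 | a * a <= K.+1) (a %| m))%N.
apply: (@leq_trans (\sum_(1 <= m < K.+1) 4 * (D m * D m.+1))%N).
  rewrite big_nat_cond [leqRHS]big_nat_cond; apply: leq_sum => m.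
  rewrite andbT => /andP[m0 mK]; apply: leq_trans (size_divisorsM m m.+1 m0 isT) _.
  rewrite -[4%N]/(2 * 2)%N mulnACA leq_mul //; apply: size_divisors_le_sum.
    by rewrite m0 ltnW.
  by rewrite ltnS.
rewrite -big_distrr leq_mul2l /=.
under eq_bigr => m _ do rewrite big_distrlr.
rewrite exchange_big; apply: leq_sum => a _.
by rewrite exchange_big; apply: leq_sum => b _; exact: count_dvdn_consecutive.
Qed.

(** Induction; the step is [ln (1 + x) <= x] at [x = - 1 / (n + 2)]. *)
Lemma harmonic_le_ln (R : realType) (n : nat) :
  \sum_(1 <= a < n.+2) (a%:R : R)^-1 <= 1 + ln (n.+1%:R : R).
Proof.
elim: n => [|n IHn]; first by rewrite big_nat1 invr1 ln1 addr0.
rewrite big_nat_recr //=; apply: le_trans (lerD IHn (lexx _)) _.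
rewrite -addrA lerD2l.
have n1 : (0 : R) < n.+1%:R by rewrite ltr0n.
have n2 : (0 : R) < n.+2%:R by rewrite ltr0n.
have qE : n.+1%:R / n.+2%:R = 1 + - n.+2%:R^-1 :> R.
  apply: (mulIf (lt0r_neq0 n2)).
  by rewrite mulrDl mulNr divfK ?mulVf ?gt_eqF // mul1r -[n.+2%:R]natr1 addrK.
have : ln (n.+1%:R / n.+2%:R : R) <= - n.+2%:R^-1.
  by rewrite qE; apply: le_ln1Dx; rewrite ltrN2 invf_lt1 // ltr1n.
rewrite ln_div ?posrE //.
by move: (ln _) (ln _) (_^-1) => x y z; lra.
Qed.

Lemma sum_size_divisors_le_harmonic (R : realType) (K : nat) :
  (\sum_(1 <= m < K.+1) size (divisors (m * m.+1)))%:R <=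
  12 * K%:R * (\sum_(1 <= a < K.+2) (a%:R : R)^-1) ^+ 2.
Proof.
case: K => [|K]; first by rewrite big_nil mulr0 mul0r.
have := sum_size_divisors_le K.+1; rewrite -(ler_nat R) => /le_trans; apply.
have -> : 12 * K.+1%:R = 4 * (3 * K.+1%:R) :> R by ring.
rewrite natrM -mulrA ler_pM2l //.
rewrite natr_sum expr2 big_distrlr mulr_sumr.
rewrite big_mkcond big_nat_cond [leRHS]big_nat_cond /=.
apply: ler_sum => a; rewrite andbT => /andP[a0 aK].
(* Indices beyond the square root only add nonnegative terms on the right. *)
case: ifPn => [aa|_]; last first.
  by rewrite mulr_ge0 // sumr_ge0 // => b _; rewrite mulr_ge0 ?invr_ge0.
rewrite natr_sum mulr_sumr big_mkcond big_nat_cond [leRHS]big_nat_cond /=.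
apply: ler_sum => b; rewrite andbT => /andP[b0 bK].
case: ifPn => [bb|_]; last by rewrite !mulr_ge0 ?invr_ge0.
(* With [K.+1] as the bound on [m], this gives [(K.+1 %/ (a * b)).+1 * (a * b) <= K.+1 + K.+2 <= 3 *
   K.+1]. *)
have abK : (a * b <= K.+2)%N.
  by rewrite -leq_sqr expnMn leq_mul // -mulnn.
have ab0 : (0 : R) < (a * b)%:R by rewrite ltr0n muln_gt0 a0.
rewrite -invfM -[a%:R * _]natrM ler_pdivlMr // -!natrM ler_nat mulSn.
have := leq_trunc_div K.+1 (a * b); lia.
Qed.

Lemma dvdn_Z (n : nat) : (0 < n)%N -> (0 < Z n)%N /\ (n %| Z n * (Z n).+1)%N.
Proof.
case: n => // n _; rewrite /Z; case: ex_minnP => m /andP[m0 nm] _; split => //.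
apply: dvdn_trans nm _; rewrite /triangular addn1.
have m2 : (2 %| m * m.+1)%N by rewrite dvdn2 oddM /= andbN.
by rewrite -{2}(divnK m2) dvdn_mulr.
Qed.

(** Each [n] counted occurs in the list of divisors of [m * m.+1] for [m = Z n], and
    [Z n < n ^ beta <= e ^ (beta * t)]. *)
Lemma card_small_Z_le (R : realType) (beta : R) (t : nat) : 0 <= beta ->
  (#|` fset_set (small_Z beta t)| <=
   \sum_(1 <= m < (Num.truncn (expR (beta * t%:R : R))).+1)
     size (divisors (m * m.+1)))%N.
Proof.
move=> beta0; set K := Num.truncn _.
have -> : (\sum_(1 <= m < K.+1) size (divisors (m * m.+1)) =
    size (flatten [seq divisors (m * m.+1) | m <- index_iota 1 K.+1]))%N.
  by rewrite size_flatten /shape -map_comp sumnE big_map.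
apply: uniq_leq_size => [|n]; first exact: fset_uniq.
rewrite in_fset_set; last exact: finite_small_Z.
rewrite inE => -[/andP[ltn len] Zn].
have n0 : (0 < n)%N by rewrite -(ltr_nat R); apply: lt_trans ltn; exact: expR_gt0.
have [Z0 nZ] := dvdn_Z n n0.
apply/flatten_mapP; exists (Z n); last by rewrite -dvdn_divisors // muln_gt0 Z0.
rewrite mem_index_iota Z0 /= ltnS truncn_ge_nat ?expR_ge0 //.
apply/ltW/(lt_le_trans Zn); rewrite mulrC expRM.
by apply: ge0_ler_powR; rewrite ?nnegrE ?expR_ge0.
Qed.

Theorem theorem4 (R : realType) (beta : R) (t : nat)
    (hbeta : 1 / 2 < beta < 1) (ht : (5 <= t)%N) :
  (#|` fset_set (small_Z beta t)|)%:R <= 196 * t%:R ^+ 2 * expR (beta * t%:R).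
Proof.
have /andP[beta_gt beta_lt] := hbeta.
have beta0 : 0 <= beta by lra.
have := card_small_Z_le R beta t beta0; rewrite -(ler_nat R) => /le_trans; apply.
apply: le_trans (sum_size_divisors_le_harmonic R _) _.
set M := expR _; set K := Num.truncn M; set H := (X in X ^+ 2).
have KM : K%:R <= M by rewrite truncn_le expR_ge0.
have t5 : (5 : R) <= t%:R by rewrite (ler_nat R 5).
have H0 : 0 <= H by apply: sumr_ge0 => a _; rewrite invr_ge0.
have Ht : H <= 3 * t%:R.
  apply: le_trans (harmonic_le_ln R K) _.
  (* Since [K + 1 <= e ^ t + 1 <= e ^ (t + 1)], the harmonic sum is at most [t + 2 <= 3 * t]. *)
  have : ln (K.+1%:R : R) <= ln (expR (t%:R + 1)).
    rewrite ler_ln ?posrE ?expR_gt0 ?ltr0n // expRD.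
    have Mt : M <= expR t%:R by rewrite ler_expR; nra.
    have e2 : 2 <= expR 1 :> R by have := expR_ge1Dx (1 : R); lra.
    have e1 : 1 <= expR t%:R :> R by have := expR_ge1Dx (t%:R : R); lra.
    by rewrite -natr1; nra.
  rewrite expRK; lra.
have H2 : H ^+ 2 <= (3 * t%:R) ^+ 2 by rewrite lerXn2r ?nnegrE ?mulr_ge0.
have -> : 196 * t%:R ^+ 2 * M = M * (196 * t%:R ^+ 2) by rewrite mulrC.
have -> : 12 * K%:R * H ^+ 2 = K%:R * (12 * H ^+ 2) by ring.
(* The constant obtained is [12 * 9 = 108], which is below [196]. *)
have H2t : 12 * H ^+ 2 <= 196 * t%:R ^+ 2.
  by rewrite exprMn in H2; have := sqr_ge0 (t%:R : R); lra.
by apply: ler_pM => //; rewrite mulr_ge0 ?sqr_ge0.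
Qed.
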